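(* Let $\alpha\in(0,1)$ and let $V_1,\dots,V_M$ be a directed chain partition of the set $V=\{f_1,\dots,f_N\}$ of firms, with input-output matrix $W=(w_{ij})$, which is weakly coupled with coupling constant $\gamma$. Fix $K<M$. For $q\le K$, let $P_q$ denote the orthogonal projection of $\mathbb R^N$ onto the span of the standard basis vectors $e_i$ with $f_i\in V_1\cup\dots\cup V_q$. If $U=(u_{ij})$ is an input-output matrix of the same firms such that $w_{ij}\ne u_{ij}$ only if $f_j\in\bigcup_{l\ge K}V_l$, then $$\|P_q(v_W-v_U)\|\le\frac{2\sqrt q\,\left|\bigcup_{i=K}^MV_i\right|}{N}\,e^{-\log(1/\gamma)(K-q)},$$ where $\|\cdot\|$ is the Euclidean norm (and $e^{-\log(1/\gamma)(K-q)}$ means $\gamma^{K-q}$).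
   Context: An input-output matrix for firms $f_1,\dots,f_N$ is a real $N\times N$ matrix $W=(w_{ij})$ with $w_{ij}\ge0$, $w_{ii}=0$ and $\sum_jw_{ij}=1$ for all $i$. With $W'$ the transpose and $\vec{\mathbf 1}$ the all-ones vector, the influence vector is $v_W=\frac{\alpha}{N}(I-(1-\alpha)W')^{-1}\vec{\mathbf 1}$ (the inverse exists). A partition of $V$ into nonempty disjoint sets $V_1,\dots,V_M$ is a directed chain for $W$ if firms interact only within the same part or between consecutive parts, and all interactions between $V_i$ and $V_{i+1}$ are directed from $V_i$ to $V_{i+1}$, in the sense that $W=\bigoplus_{i=1}^MW_i+\sum_{i=1}^{M-1}W_{\mathrm{int}}^{(i,i+1)}$ where $W_i$ is the block of $W$ with rows and columns in $V_i$, and, with respect to the ordering $V_i,V_{i+1}$, $$(W_{\mathrm{int}}^{(i,i+1)})'=\begin{bmatrix}0&A_1^{(i,i+1)}\\0&0\end{bmatrix}.$$ Equivalently: $w_{ab}\ne0$ only if $f_a,f_b$ lie in the same part, or $f_a\in V_{i+1}$ and $f_b\in V_i$ for some $i$; and $A_1^{(i,i+1)}$ is the $|V_i|\times|V_{i+1}|$ matrix whose $(f_b,f_a)$ entry is $w_{ab}$ for $f_b\in V_i$, $f_a\in V_{i+1}$. Let $m_i=|V_i|$. The coupling constant is $\gamma=(1-\alpha)\max_{1\le i\le M-1}\left\|(I_{m_i}-(1-\alpha)W_i')^{-1}A_1^{(i,i+1)}\right\|$ (spectral norm), and the chain is weakly coupled if $\gamma<1$. *)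

(* Defs.v *)
From mathcomp Require Import all_boot all_order all_algebra.
From mathcomp Require Import classical_sets reals.

Set Implicit Arguments.
Unset Strict Implicit.
Unset Printing Implicit Defensive.

Import Order.TTheory GRing.Theory Num.Theory.
Local Open Scope ring_scope.

Definition enorm (R : realType) (n : nat) (x : 'cV[R]_n) : R :=
  Num.sqrt (\sum_(i < n) x i 0 ^+ 2).

(* The operator norm induced by [enorm]; in finite dimension the set is bounded
   (and contains 0), so [sup] takes its genuine value, never its default. *)
Definition specnorm (R : realType) (m n : nat) (A : 'M[R]_(m, n)) : R :=
  sup [set r : R | exists2 x : 'cV[R]_n, enorm x <= 1 & r = enorm (A *m x)]%classic.

Definition input_output (R : realType) (N : nat) (W : 'M[R]_N) : Prop :=
  [/\ forall i j, 0 <= W i j,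
      forall i, W i i = 0
    & forall i, \sum_(j < N) W i j = 1].

(* [invmx] returns its argument on a singular matrix; here and in [coupling],
   for 0 < alpha < 1 and W an input-output matrix, the inverted matrices are
   nonsingular, so the default is not used. *)
Definition influence (R : realType) (N : nat) (alpha : R) (W : 'M[R]_N)
    : 'cV[R]_N :=
  (alpha / N%:R) *: (invmx (1%:M - (1 - alpha) *: W^T) *m const_mx 1).

(* Families of parts are indexed by nat; only V 1, ..., V M are meaningful. *)
Definition is_partition (N M : nat) (V : nat -> {set 'I_N}) : Prop :=
  [/\ forall i, (1 <= i <= M)%N -> (0 < #|V i|)%N,
      forall i j, (1 <= i <= M)%N -> (1 <= j <= M)%N -> i <> j ->
        [disjoint V i & V j]
    & \bigcup_(1 <= i < M.+1) V i = [set: 'I_N]%SET].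

(* Rows and columns are listed in the increasing order of the indices. *)
Definition block (R : realType) (N : nat) (S T : {set 'I_N}) (W : 'M[R]_N)
    : 'M[R]_(#|S|, #|T|) :=
  \matrix_(k, l) W (enum_val k) (enum_val l).

(* The N x N matrix equal to B on S x T, and to 0 elsewhere. *)
Definition embed (R : realType) (N : nat) (S T : {set 'I_N})
    (B : 'M[R]_(#|S|, #|T|)) : 'M[R]_N :=
  \matrix_(a, b)
    \sum_(k < #|S| | enum_val k == a) \sum_(l < #|T| | enum_val l == b) B k l.

Definition diag_block (R : realType) (N : nat) (V : nat -> {set 'I_N})
    (W : 'M[R]_N) (i : nat) : 'M[R]_(#|V i|) :=
  block (V i) (V i) W.

(* A_1^(i,i+1): its (b, a) entry is w_ab, for b in V_i and a in V_(i+1). *)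
Definition coupling_block (R : realType) (N : nat) (V : nat -> {set 'I_N})
    (W : 'M[R]_N) (i : nat) : 'M[R]_(#|V i|, #|V i.+1|) :=
  block (V i) (V i.+1) W^T.

Definition directed_chain (R : realType) (N M : nat) (V : nat -> {set 'I_N})
    (W : 'M[R]_N) : Prop :=
  is_partition M V /\
  W = \sum_(1 <= i < M.+1) embed (diag_block V W i)
      + \sum_(1 <= i < M) (embed (coupling_block V W i))^T.

(* The initial value 0 of the maximum is harmless when 1 < M, norms being
   nonnegative. *)
Definition coupling (R : realType) (N M : nat) (alpha : R)
    (V : nat -> {set 'I_N}) (W : 'M[R]_N) : R :=
  (1 - alpha) *
  \big[Num.max/0]_(1 <= i < M)
    specnorm (invmx (1%:M - (1 - alpha) *: (diag_block V W i)^T)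
              *m coupling_block V W i).

(* Orthogonal projection onto span {e_i : i in S}, as the sum of the
   e_i e_i^T; see [coord_projP]. *)
Definition coord_proj (R : realType) (N : nat) (S : {set 'I_N}) : 'M[R]_N :=
  \sum_(i in S) (delta_mx i 0 : 'cV[R]_N) *m (delta_mx i 0 : 'cV[R]_N)^T.

Lemma coord_projE (R : realType) (N : nat) (S : {set 'I_N}) (x : 'cV[R]_N) i :
  (coord_proj R S *m x) i 0 = if i \in S then x i 0 else 0.
Proof.
rewrite /coord_proj mulmx_suml summxE.
under eq_bigr => k _.
  rewrite trmx_delta -mulmxA -rowE mxE big_ord1 !mxE andbT.
  over.
case: ifPn => iS.
  rewrite (bigD1 i) //= eqxx mul1r big1 ?addr0 // => k /andP[_ /negPf ki].
  by rewrite eq_sym ki mul0r.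
rewrite big1 // => k kS; case: eqP => [ik|_]; last by rewrite mul0r.
by rewrite ik kS in iS.
Qed.

Lemma coord_projP (R : realType) (N : nat) (S : {set 'I_N}) (x : 'cV[R]_N) :
  (exists c : 'I_N -> R,
    coord_proj R S *m x = \sum_(i in S) c i *: delta_mx i 0) /\
  (forall i, i \in S ->
    ((delta_mx i 0 : 'cV[R]_N)^T *m (x - coord_proj R S *m x)) = 0).
Proof.
split=> [|i iS].
  exists (fun i => x i 0); apply/colP => j; rewrite coord_projE summxE.
  under eq_bigr do rewrite !mxE andbT.
  case: ifPn => jS.
    rewrite (bigD1 j) //= eqxx mulr1 big1 ?addr0 // => k /andP[_ /negPf kj].
    by rewrite eq_sym kj mulr0.
  rewrite big1 // => k kS; case: eqP => [jk|_]; last by rewrite mulr0.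
  by rewrite jk kS in jS.
by rewrite trmx_delta -rowE; apply/colP => j; rewrite ord1 mxE mxE
  [X in _ + X]mxE coord_projE iS subrr mxE.
Qed.

Lemma embed_block (R : realType) (N : nat) (S T : {set 'I_N}) (W : 'M[R]_N) a b :
  embed (block S T W) a b = if (a \in S) && (b \in T) then W a b else 0.
Proof.
rewrite mxE; case: ifPn => [/andP[aS bT]|].
  rewrite (bigD1 (enum_rank_in aS a)) ?enum_rankK_in //= [X in _ + X]big1 ?addr0.
    rewrite (bigD1 (enum_rank_in bT b)) ?enum_rankK_in //= [X in _ + X]big1 ?addr0.
      by rewrite mxE !enum_rankK_in.
    move=> l /andP[/eqP lb /eqP[]].
    by apply: enum_val_inj; rewrite enum_rankK_in.
  move=> k /andP[/eqP ka /eqP[]].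
  by apply: enum_val_inj; rewrite enum_rankK_in.
move=> nST; apply: big1 => k /eqP ka; apply: big1 => l /eqP lb.
by case/negP: nST; rewrite -ka -lb !enum_valP.
Qed.

Lemma sum_nat_if_unique (R : realType) (n i0 : nat) (P : pred nat) (c : R) :
  (1 <= i0 < n)%N -> P i0 ->
  (forall i, (1 <= i < n)%N -> P i -> i = i0) ->
  \sum_(1 <= i < n) (if P i then c else 0) = c.
Proof.
move=> hi0 Pi0 Pu; rewrite (bigD1_seq i0) ?iota_uniq ?mem_index_iota //= Pi0.
rewrite big_seq_cond big1 ?addr0 // => i /andP[]; rewrite mem_index_iota => hi.
by case: ifP => // /(Pu _ hi) ->; rewrite eqxx.
Qed.

Lemma directed_chainP (R : realType) (N M : nat) (V : nat -> {set 'I_N})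
    (W : 'M[R]_N) :
  is_partition M V ->
  directed_chain M V W <->
  (forall a b, W a b != 0 ->
    (exists2 i, (1 <= i <= M)%N & (a \in V i) && (b \in V i)) \/
    (exists2 i, (1 <= i < M)%N & (a \in V i.+1) && (b \in V i))).
Proof.
move=> hV; have [_ dV _] := hV.
have Vu x i j : (1 <= i <= M)%N -> (1 <= j <= M)%N ->
    x \in V i -> x \in V j -> i = j.
  move=> hi hj xi xj; apply/eqP; apply: contraT => /eqP /(dV _ _ hi hj).
  by move/pred0P/(_ x); rewrite /= xi xj.
set D := \sum_(1 <= i < M.+1) embed (diag_block V W i).
set I := \sum_(1 <= i < M) (embed (coupling_block V W i))^T.
have DE a b : D a b = \sum_(1 <= i < M.+1)
    (if (a \in V i) && (b \in V i) then W a b else 0).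
  by rewrite summxE; apply: eq_bigr => i _; rewrite embed_block.
have IE a b : I a b = \sum_(1 <= i < M)
    (if (a \in V i.+1) && (b \in V i) then W a b else 0).
  rewrite summxE; apply: eq_bigr => i _.
  by rewrite mxE embed_block mxE andbC.
split=> [[_ EW] a b Wab|H].
  have [/hasP[i]|nD] := boolP
      (has (fun i => (a \in V i) && (b \in V i)) (index_iota 1 M.+1)).
    by rewrite mem_index_iota => hi Hi; left; exists i.
  have [/hasP[i]|nI] := boolP
      (has (fun i => (a \in V i.+1) && (b \in V i)) (index_iota 1 M)).
    by rewrite mem_index_iota => hi Hi; right; exists i.
  case/eqP: Wab; rewrite EW -/D -/I mxE DE IE.
  rewrite !big_seq !big1 ?addr0 // => i hi; case: ifP => // Hi.
    by case/hasP: nI; exists i.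
  by case/hasP: nD; exists i.
split=> //; rewrite -/D -/I; apply/matrixP => a b; rewrite mxE DE IE.
have [->|/H] := eqVneq (W a b) 0.
  by rewrite !big1 ?addr0 // => i _; case: ifP.
case=> [[i hi /andP[ai bi]]|[i /andP[i1 iM] /andP[ai bi]]].
  rewrite (@sum_nat_if_unique _ _ i) ?ai ?bi //; last first.
    by move=> j hj /andP[aj _]; apply: Vu aj ai.
  rewrite big_nat big1 ?addr0 // => j /andP[j1 jM]; case: ifP => // /andP[aj bj].
  have Ej : j = i by apply: Vu bj bi => //; rewrite j1 ltnW.
  have /eqP : j.+1 = i by apply: Vu aj ai.
  by rewrite Ej eqn_leq ltnn.
rewrite [X in _ + X](@sum_nat_if_unique _ _ i) ?i1 ?ai ?bi //; last first.
  by move=> j /andP[j1 jM] /andP[_ bj]; apply: Vu bj bi; rewrite ?j1 ?i1 ltnW.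
rewrite big_nat big1 ?add0r // => j hj; case: ifP => // /andP[aj bj].
have Ej : j = i by apply: Vu bj bi => //; rewrite i1 ltnW.
have /eqP : j = i.+1 by apply: Vu aj ai.
by rewrite Ej eqn_leq ltnn andbF.
Qed.

(* Main.v *)
(** The difference [d] of the influence vectors solves
    [(I - (1 - alpha) W') d = (1 - alpha) (W' - U') v_U], whose right-hand side
    is supported on the last parts V_l, l >= K.  Hence, on each V_l with l < K,
    [d_l = (1 - alpha) (I - (1 - alpha) W_l')^-1 A_1^(l,l+1) d_(l+1)], so norms
    shrink by a factor gamma per part when moving away from V_K.  On V_K, the
    norm of [d] is at most the mass of [v_W + v_U] on T, the union of the V_l
    with l >= K.  No row outside T has weight in T, neither for W (chain) nor for
    U (its rows sum to 1 and agree with W off T), so each of the two masses is at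
    most |T| / N. *)

Require Import Defs.
From mathcomp Require Import all_boot all_order all_algebra.
From mathcomp Require Import reals.
Import Order.TTheory GRing.Theory Num.Theory.
Local Open Scope ring_scope.

(** * Unions of parts over an interval of indices *)

Lemma bigcup_natP {N : nat} (V : nat -> {set 'I_N}) (m n : nat) (x : 'I_N) :
  reflect (exists2 l, (m <= l < n)%N & x \in V l)
          (x \in \bigcup_(m <= l < n) V l).
Proof.
have mem_cup :
    {morph (fun A : {set 'I_N} => x \in A) : A B / A :|: B >-> A || B}.
  by move=> A B; rewrite inE.
rewrite (big_morph _ mem_cup (in_set0 x)) big_has.
by apply: (iffP hasP) => -[l]; rewrite ?mem_index_iota => hl xl;
  exists l; rewrite ?mem_index_iota.
Qed.

Lemma sum_bigcup_nat_le {R : realType} {N : nat} (V : nat -> {set 'I_N})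
    (m n : nat) (F : 'I_N -> R) : (forall i, 0 <= F i) ->
  \sum_(i in \bigcup_(m <= l < n) V l) F i
  <= \sum_(m <= l < n) \sum_(i in V l) F i.
Proof.
move=> F0; apply: (big_rec2 (fun (A : {set 'I_N}) s => \sum_(i in A) F i <= s)).
  by rewrite big_set0.
move=> l A s _ As; apply: le_trans (lerD (lexx _) As).
rewrite (big_setID (V l)) /= setUK lerD2l.
rewrite big_mkcond [leRHS]big_mkcond; apply: ler_sum => i _.
by rewrite !inE; case: (i \in V l); case: (i \in A).
Qed.

(** * Euclidean and spectral norms *)

Lemma enorm_ge0 {R : realType} {n : nat} (x : 'cV[R]_n) : 0 <= enorm x.
Proof. exact: sqrtr_ge0. Qed.

Lemma enorm_sqr {R : realType} {n : nat} (x : 'cV[R]_n) :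
  enorm x ^+ 2 = \sum_i x i 0 ^+ 2.
Proof. by rewrite sqr_sqrtr // sumr_ge0 // => i _; rewrite sqr_ge0. Qed.

Lemma enormZ {R : realType} {n : nat} (a : R) (x : 'cV[R]_n) :
  enorm (a *: x) = `|a| * enorm x.
Proof.
rewrite /enorm -sqrtr_sqr -sqrtrM ?sqr_ge0 // mulr_sumr.
by congr (Num.sqrt _); apply: eq_bigr => i _; rewrite mxE exprMn.
Qed.

Lemma ler_abs_enorm {R : realType} {n : nat} (x : 'cV[R]_n) i :
  `|x i 0| <= enorm x.
Proof.
rewrite -(ler_pXn2r (_ : 0 < 2)%N) ?nnegrE ?enorm_ge0 //.
rewrite enorm_sqr real_normK ?num_real // (bigD1 i) //= lerDl.
by apply: sumr_ge0 => j _; rewrite sqr_ge0.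
Qed.

Lemma enorm_le_sum_abs {R : realType} {n : nat} (x : 'cV[R]_n) :
  enorm x <= \sum_i `|x i 0|.
Proof.
have S0 : 0 <= \sum_i `|x i 0| by apply: sumr_ge0.
rewrite -(ler_pXn2r (_ : 0 < 2)%N) ?nnegrE ?enorm_ge0 //.
rewrite enorm_sqr expr2 mulr_suml; apply: ler_sum => i _.
rewrite -real_normK ?num_real // expr2 ler_wpM2l // (bigD1 i) //= lerDl.
exact: sumr_ge0.
Qed.

(** The supremum is over a set bounded by the sum of the absolute values of the entries, hence
    bounds every unit vector; a nonzero [x] is scaled to norm 1. *)
Lemma enorm_mulmx_le_specnorm {R : realType} {m n : nat} (A : 'M[R]_(m, n))
    (x : 'cV[R]_n) :
  enorm (A *m x) <= specnorm A * enorm x.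
Proof.
have unit_le y : enorm y <= 1 -> enorm (A *m y) <= specnorm A.
  move=> y1; apply: ub_le_sup; last by exists y.
  exists (\sum_i \sum_j `|A i j|) => _ [z z1 ->].
  apply: le_trans (enorm_le_sum_abs _) _; apply: ler_sum => i _.
  rewrite mxE; apply: le_trans (ler_norm_sum _ _ _) _; apply: ler_sum => j _.
  by rewrite normrM ler_piMr // (le_trans (ler_abs_enorm z j)).
(* The zero vector cannot be normalized and is treated apart. *)
have [x0|xn0] := eqVneq (enorm x) 0.
  rewrite x0 mulr0; have -> : x = 0.
    apply/colP => i; apply/eqP; rewrite mxE -normr_le0 -x0.
    exact: ler_abs_enorm.
  by rewrite mulmx0 -[in leLHS](scale0r 0) enormZ normr0 mul0r.
have x_gt0 : 0 < enorm x by rewrite lt_def xn0 enorm_ge0.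
rewrite -ler_pdivrMr // mulrC -[X in X * _]gtr0_norm ?invr_gt0 //.
rewrite -enormZ scalemxAr unit_le //.
by rewrite enormZ gtr0_norm ?invr_gt0 // mulVf.
Qed.

Lemma enorm_coord_proj_sqr {R : realType} {N : nat} (S : {set 'I_N})
    (x : 'cV[R]_N) :
  enorm (coord_proj R S *m x) ^+ 2 = \sum_(i in S) x i 0 ^+ 2.
Proof.
rewrite enorm_sqr [RHS]big_mkcond; apply: eq_bigr => i _.
by rewrite coord_projE; case: ifP => // _; rewrite expr0n.
Qed.

(** * Substochastic matrices *)

(* With [c = 0] and [T] the full set this says that [x] vanishes, which gives
   both the invertibility of [1 - b A^T] and the nonnegativity of influences. *)
Lemma substochastic_mass_le {R : realType} {n : nat} (T : {set 'I_n})
    (A : 'M[R]_n) (b c : R) (x : 'I_n -> R) :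
    (forall i j, 0 <= A i j) -> (forall i, \sum_j A i j <= 1) ->
    (forall i j, i \notin T -> j \in T -> A i j = 0) ->
    0 <= b -> (forall i, 0 <= x i) ->
    (forall j, j \in T -> x j <= c + b * \sum_i A i j * x i) ->
  (1 - b) * \sum_(j in T) x j <= c * #|T|%:R.
Proof.
move=> A0 A1 AT b0 x0 xle.
rewrite mulrBl mul1r lerBlDr.
apply: le_trans (ler_sum _ xle) _.
rewrite big_split /= sumr_const mulr_natr lerD2l -mulr_sumr ler_wpM2l //.
(* After the exchange, a row outside [T] contributes nothing, and a row [i] in [T] contributes [x i]
   times its weight in [T], which is at most 1. *)
rewrite exchange_big /= (bigID (mem T)) /= [X in _ + X]big1 ?addr0; last first.
  by move=> i iT; apply: big1 => j jT; rewrite AT // mul0r.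
apply: ler_sum => i _; rewrite -mulr_suml ler_piMl //.
apply: le_trans (A1 i); rewrite [leRHS](bigID (mem T)) /= lerDl.
exact: sumr_ge0.
Qed.

Lemma substochastic_subfixed0 {R : realType} {n : nat} (A : 'M[R]_n) (b : R)
    (x : 'I_n -> R) :
    (forall i j, 0 <= A i j) -> (forall i, \sum_j A i j <= 1) ->
    0 <= b < 1 -> (forall i, 0 <= x i) ->
    (forall j, x j <= b * \sum_i A i j * x i) ->
  forall j, x j = 0.
Proof.
move=> A0 A1 /andP[b0 b1] x0 xle j.
have := @substochastic_mass_le R n setT A b 0 x A0 A1.
rewrite mul0r pmulr_rle0 ?subr_gt0 // => S0.
apply: le_anti; rewrite x0 andbT.
apply: le_trans (S0 _ b0 x0 _).
- by rewrite (bigD1 j) ?inE //= lerDl sumr_ge0.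
- by move=> i k; rewrite inE.
- by move=> k _; rewrite add0r.
Qed.

(** A row [y] in the left kernel of the transpose satisfies [y = b *: (y *m A)]. By the triangle
    inequality its absolute values satisfy the hypothesis of [substochastic_subfixed0], so [y]
    vanishes. *)
Lemma substochastic_unitmx {R : realType} {n : nat} (A : 'M[R]_n) (b : R) :
    (forall i j, 0 <= A i j) -> (forall i, \sum_j A i j <= 1) -> 0 <= b < 1 ->
  1%:M - b *: A^T \in unitmx.
Proof.
move=> A0 A1 b01; rewrite -unitmx_tr -row_free_unit -kermx_eq0.
apply/eqP/row_matrixP => r; rewrite row0.
have : row r (kermx (1%:M - b *: A^T)^T) *m (1%:M - b *: A^T)^T = 0.
  by rewrite -row_mul mulmx_ker row0.
move: (row r _) => y.
rewrite linearB /= trmx1 linearZ /= trmxK mulmxBr mulmx1 -scalemxAr.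
move/eqP; rewrite subr_eq0 => /eqP yE.
apply/rowP => j; rewrite [RHS]mxE; apply/eqP; rewrite -normr_eq0; apply/eqP.
move: j; apply: (@substochastic_subfixed0 R n A b (fun j => `|y 0 j|)) => // j.
have /andP[b0 _] := b01.
rewrite [in leLHS]yE mxE normrM ger0_norm // ler_wpM2l //.
rewrite mxE (le_trans (ler_norm_sum _ _ _)) //; apply: ler_sum => i _.
by rewrite normrM mulrC (ger0_norm (A0 _ _)).
Qed.

(** * Influence vectors *)

(** Multiplying by the matrix, invertible by [substochastic_unitmx], removes [invmx]. Everything
    below uses influences only through this fixed-point equation. *)
Lemma influenceE {R : realType} {N : nat} {alpha : R} {W : 'M[R]_N} :
    0 < alpha < 1 -> input_output W ->
  forall j, influence alpha W j 0 =
    alpha / N%:R + (1 - alpha) * \sum_i W i j * influence alpha W i 0.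
Proof.
move=> /andP[a0 a1] [W0 _ W1] j.
have b01 : 0 <= 1 - alpha < 1 by rewrite subr_ge0 ltW //= ltrBlDr ltrDl.
have Wu : 1%:M - (1 - alpha) *: W^T \in unitmx.
  by apply: substochastic_unitmx => // i; rewrite W1.
have : (1%:M - (1 - alpha) *: W^T) *m influence alpha W
       = (alpha / N%:R) *: const_mx 1.
  by rewrite -scalemxAr mulKVmx.
rewrite mulmxBl mul1mx -scalemxAl => /colP/(_ j).
rewrite !mxE mulr1 => /eqP; rewrite subr_eq => /eqP ->.
by congr (_ + _ * _); apply: eq_bigr => i _; rewrite mxE.
Qed.

(** The constant term of the fixed-point equation is nonnegative, so the negative part
    [Num.max 0 (- v j 0)] is bounded by its own damped image under [W] and vanishes. *)
Lemma influence_ge0 {R : realType} {N : nat} {alpha : R} {W : 'M[R]_N} :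
    0 < alpha < 1 -> input_output W -> forall j, 0 <= influence alpha W j 0.
Proof.
move=> halpha hW; have vE := influenceE halpha hW.
have [/andP[a0 a1] [W0 _ W1]] := (halpha, hW).
have b01 : 0 <= 1 - alpha < 1 by rewrite subr_ge0 ltW //= ltrBlDr ltrDl.
have /andP[b0 _] := b01.
set v := influence alpha W in vE *.
suff max0 j : Num.max 0 (- v j 0) = 0.
  by move=> j; rewrite -oppr_le0 -(max0 j) le_max lexx orbT.
move: j; apply: (@substochastic_subfixed0 R N W (1 - alpha)) => // [i|i|j].
- by rewrite W1.
- by rewrite le_max lexx.
rewrite ge_max mulr_ge0 ?sumr_ge0 //=; last first.
  by move=> i _; rewrite mulr_ge0 // le_max lexx.
rewrite vE opprD -[- (_ * \sum_i _)]mulrN -sumrN.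
apply: le_trans (_ : 0 + _ <= _).
  apply: lerD (lexx _); rewrite oppr_le0 divr_ge0 // ltW //.
rewrite add0r ler_wpM2l //; apply: ler_sum => i _.
by rewrite -mulrN ler_wpM2l // le_max lexx orbT.
Qed.

Lemma influence_mass_le {R : realType} {N : nat} {alpha : R} {W : 'M[R]_N}
    {T : {set 'I_N}} :
    0 < alpha < 1 -> input_output W ->
    (forall i j, i \notin T -> j \in T -> W i j = 0) ->
  \sum_(j in T) influence alpha W j 0 <= #|T|%:R / N%:R.
Proof.
move=> halpha hW WT; have [/andP[a0 a1] [W0 _ W1]] := (halpha, hW).
have := @substochastic_mass_le R N T W (1 - alpha) (alpha / N%:R)
  (fun j => influence alpha W j 0) W0 _ WT _ (influence_ge0 halpha hW) _.
(* With [b = 1 - alpha] and [c = alpha / N], the factor [1 - b] is [alpha] and cancels. *)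
rewrite subKr -mulrA (ler_pM2l a0) [_^-1 * _]mulrC.
apply=> [i||j _]; first by rewrite W1.
  by rewrite subr_ge0 ltW.
by rewrite {1}influenceE.
Qed.

(** * Restriction to parts and contraction along the chain *)

(** Coordinates follow the enumeration used by [block], so that blocks act on these vectors. *)
Definition subvec {R : realType} {N : nat} (S : {set 'I_N}) (x : 'cV[R]_N) :
    'cV[R]_#|S| :=
  \col_k x (enum_val k) 0.

Lemma enorm_subvec_sqr {R : realType} {N : nat} (S : {set 'I_N})
    (x : 'cV[R]_N) :
  enorm (subvec S x) ^+ 2 = \sum_(i in S) x i 0 ^+ 2.
Proof.
by rewrite enorm_sqr [RHS]big_enum_val; apply: eq_bigr => i _; rewrite mxE.
Qed.

Lemma mul_block_subvec {R : realType} {N : nat} (S T : {set 'I_N})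
    (A : 'M[R]_N) (x : 'cV[R]_N) k :
  (block S T A *m subvec T x) k 0 = \sum_(j in T) A (enum_val k) j * x j 0.
Proof.
by rewrite [RHS]big_enum_val mxE; apply: eq_bigr => i _; rewrite !mxE.
Qed.

Lemma partition_uniq {N M : nat} {V : nat -> {set 'I_N}} {x i j} :
    is_partition M V -> (1 <= i <= M)%N -> (1 <= j <= M)%N ->
  x \in V i -> x \in V j -> i = j.
Proof.
move=> [_ dV _] hi hj xi xj; apply/eqP; apply: contraT => /eqP /(dV _ _ hi hj).
by move/pred0P/(_ x); rewrite /= xi xj.
Qed.

(** Disjointness of the parts forces the index given by [directed_chainP] to be [l]. *)
Lemma chain_pred {R : realType} {N M : nat} {V : nat -> {set 'I_N}}
    {W : 'M[R]_N} {l a b} :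
    directed_chain M V W -> (1 <= l <= M)%N -> b \in V l -> W a b != 0 ->
  a \in V l \/ (l < M)%N /\ a \in V l.+1.
Proof.
move=> hchain hl bl; have [hV _] := hchain.
have /(directed_chainP W hV) H := hchain.
case/H=> [[i hi /andP[ai bi]]|[i /andP[i1 iM] /andP[ai bi]]].
  by left; rewrite (partition_uniq hV hl hi bl bi).
right; rewrite (partition_uniq hV hl _ bl bi) //.
by rewrite i1 ltnW.
Qed.

Lemma coupling_ge0 {R : realType} {N : nat} (M : nat) (alpha : R)
    (V : nat -> {set 'I_N}) (W : 'M[R]_N) :
  0 < alpha < 1 -> 0 <= coupling M alpha V W.
Proof.
by move=> /andP[_ a1]; rewrite mulr_ge0 ?bigmax_ge_id // subr_ge0 ltW.
Qed.

Lemma chain_contraction {R : realType} {N M : nat} (alpha : R)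
    (V : nat -> {set 'I_N}) (W : 'M[R]_N) (d : 'cV[R]_N) l :
    0 < alpha < 1 -> input_output W -> directed_chain M V W ->
    (1 <= l < M)%N ->
    (forall j, j \in V l -> d j 0 = (1 - alpha) * \sum_i W i j * d i 0) ->
  enorm (subvec (V l) d) <= coupling M alpha V W * enorm (subvec (V l.+1) d).
Proof.
move=> /andP[a0 a1] [W0 _ W1] hchain hl dE; have [hV _] := hchain.
have /andP[l1 lM] := hl.
have hl' : (1 <= l <= M)%N by rewrite l1 ltnW.
have hS : (1 <= l.+1 <= M)%N by [].
set b := 1 - alpha in dE *.
have b0 : 0 <= b by rewrite subr_ge0 ltW.
set Q := 1%:M - b *: (diag_block V W l)^T.
have Qu : Q \in unitmx.
  (* A row of the diagonal block may sum to less than 1, since a firm of [V l] may also have weight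
     in the preceding part. *)
  apply: substochastic_unitmx => [i j|i|].
  - by rewrite mxE.
  - have -> : \sum_j diag_block V W l i j = \sum_(j in V l) W (enum_val i) j.
      by rewrite [RHS]big_enum_val; apply: eq_bigr => j _; rewrite mxE.
    by rewrite -(W1 (enum_val i)) [leRHS](bigID (mem (V l))) /= lerDl sumr_ge0.
  - by rewrite b0 /= ltrBlDr ltrDl.
have QE : Q *m subvec (V l) d
          = b *: (coupling_block V W l *m subvec (V l.+1) d).
  rewrite mulmxBl mul1mx -scalemxAl; apply/colP => k.
  have -> : (diag_block V W l)^T = block (V l) (V l) W^T.
    by apply/matrixP => i j; rewrite !mxE.
  rewrite mxE [X in _ + X]mxE [X in _ - X]mxE mul_block_subvec.
  rewrite [RHS]mxE mul_block_subvec mxE dE ?enum_valP // -mulrBr; congr (_ * _).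
  apply/eqP; rewrite subr_eq addrC; apply/eqP.
  (* Rows in [V l] give the diagonal block. Among the others, only those in [V l.+1] have weight in
     column [enum_val k], by [chain_pred]. *)
  rewrite (bigID (mem (V l))) /=; congr (_ + _).
    by apply: eq_bigr => i _; rewrite mxE.
  rewrite big_mkcond [RHS]big_mkcond; apply: eq_bigr => i _; rewrite mxE.
  have [il|nil] := boolP (i \in V l).
    case: ifP => // iS; have /eqP := partition_uniq hV hl' hS il iS.
    by rewrite ltn_eqF.
  case: ifP => //= niS.
  have [->|/(chain_pred hchain hl' (enum_valP k))] :=
    eqVneq (W i (enum_val k)) 0; first by rewrite mul0r.
  by rewrite (negPf nil) niS => -[|[]].
rewrite -(mulKmx Qu (subvec (V l) d)) QE -scalemxAr mulmxA enormZ ger0_norm //.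
rewrite /coupling -mulrA ler_wpM2l //.
apply: le_trans (enorm_mulmx_le_specnorm _ _) _.
rewrite ler_wpM2r ?enorm_ge0 //.
by apply: (@le_bigmax_seq _ _ _ _ 0 l) => //; rewrite mem_index_iota.
Qed.

(** * Decay of the difference of influences away from [V K] *)

Theorem theorem8p1 (R : realType) (N M : nat) (alpha : R)
    (V : nat -> {set 'I_N}) (W U : 'M[R]_N) (K : nat)
    (halpha : 0 < alpha < 1)
    (hW : input_output W)
    (hchain : directed_chain M V W)
    (hweak : coupling M alpha V W < 1)
    (hK : (1 <= K < M)%N)
    (hU : input_output U)
    (hWU : forall i j, W i j <> U i j -> j \in \bigcup_(K <= l < M.+1) V l)
    (q : nat) (hq : (q <= K)%N) :
  enorm (coord_proj R (\bigcup_(1 <= l < q.+1) V l)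
         *m (influence alpha W - influence alpha U))
  <= 2 * Num.sqrt q%:R * #|\bigcup_(K <= i < M.+1) V i|%:R / N%:R
     * coupling M alpha V W ^+ (K - q).
Proof.
set T := \bigcup_(K <= l < M.+1) V l in hWU *.
set g := coupling M alpha V W in hweak *.
set d := influence alpha W - influence alpha U.
have dE j : d j 0 = influence alpha W j 0 - influence alpha U j 0.
  by rewrite mxE [X in _ + X]mxE.
have [hV _] := hchain; have /andP[K1 KM] := hK.
have g0 : 0 <= g by apply: coupling_ge0.
have WT i j : i \notin T -> j \in T -> W i j = 0.
  move=> iT /bigcup_natP[l /andP[Kl lM] jl]; apply/eqP; apply: contraT => Wij.
  case/negP: iT; apply/bigcup_natP.
  have hl : (1 <= l <= M)%N by rewrite (leq_trans K1 Kl).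
  have [il|[lM' il]] := chain_pred hchain hl jl Wij.
    by exists l; rewrite ?Kl.
  by exists l.+1; rewrite ?(leqW Kl).
have WU i j : j \notin T -> W i j = U i j.
  by move=> jT; apply/eqP; apply: contraNT jT => /eqP /hWU.
have UT i j : i \notin T -> j \in T -> U i j = 0.
  move=> iT; have [[_ _ W1] [U0 _ U1]] := (hW, hU).
  (* Off [T] the row [i] of [U] equals that of [W], which already has total weight 1 there; being
     nonnegative, the entries left over in [T] are all zero. *)
  have /eqP : \sum_(k in T) U i k = 0.
    apply: (addIr (\sum_(k | k \notin T) U i k)); rewrite add0r.
    have := U1 i; rewrite (bigID (mem T)) /= => ->.
    rewrite -(W1 i) (bigID (mem T)) /= big1 ?add0r => [|k kT]; last exact: WT.
    by apply: eq_bigr => k /WU.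
  rewrite psumr_eq0 // => /allP /(_ j) H jT.
  by apply/eqP; apply: (implyP (H _)).
have dK : enorm (subvec (V K) d) <= 2 * #|T|%:R / N%:R.
  (* Passing to the sum of absolute values and enlarging [V K] to [T] makes the mass bounds
     applicable, one for [W] and one for [U]: hence the factor 2. *)
  apply: le_trans (enorm_le_sum_abs _) _.
  have -> : \sum_i `|subvec (V K) d i 0| = \sum_(i in V K) `|d i 0|.
    by rewrite [RHS]big_enum_val; apply: eq_bigr => i _; rewrite mxE.
  apply: (@le_trans _ _ (\sum_(i in T) `|d i 0|)).
    rewrite big_mkcond [leRHS]big_mkcond; apply: ler_sum => i _.
    case: ifP => [iK|_]; last by case: ifP.
    suff -> : i \in T by [].
    by apply/bigcup_natP; exists K; rewrite // leqnn ltnW.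
  rewrite -mulrA mulrDl mul1r.
  apply: le_trans (lerD (influence_mass_le halpha hW WT)
                        (influence_mass_le halpha hU UT)).
  rewrite -big_split /=; apply: ler_sum => i _; rewrite dE.
  apply: le_trans (ler_normB _ _) _.
  by rewrite !ger0_norm // influence_ge0.
have step l : (1 <= l < K)%N ->
    enorm (subvec (V l) d) <= g * enorm (subvec (V l.+1) d).
  move=> /andP[l1 lK]; have lM := ltn_trans lK KM.
  apply: chain_contraction => //; first by rewrite l1.
  move=> j jl; rewrite dE (influenceE halpha hW) (influenceE halpha hU).
  rewrite opprD addrACA subrr add0r -mulrBr; congr (_ * _).
  (* Since [l < K], the column [j] lies outside [T], where [W] and [U] agree. *)
  rewrite -sumrB; apply: eq_bigr => i _; rewrite dE mulrBr WU //.
  apply/bigcup_natP => -[k /andP[Kk kM] jk].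
  have kl : l = k.
    apply: (partition_uniq hV _ _ jl jk); first by rewrite l1 ltnW.
    by rewrite (leq_trans K1 Kk).
  by move: lK; rewrite kl ltnNge Kk.
(* Induction on the distance [k] to [V K]; the bound [k < K] keeps the index [K - k] at least 1. *)
have decay k : (k < K)%N ->
    enorm (subvec (V (K - k)%N) d) <= g ^+ k * enorm (subvec (V K) d).
  elim: k => [|k IH] kK; first by rewrite subn0 mul1r.
  have /step : (1 <= K - k.+1 < K)%N by rewrite subn_gt0 kK ltn_subrL K1.
  rewrite subnSK ?(ltnW kK) // => /le_trans; apply.
  by rewrite exprS -mulrA ler_wpM2l // IH // ltnW.
set B := enorm (subvec (V K) d) in dK decay.
have part l : (1 <= l < q.+1)%N ->
    \sum_(i in V l) d i 0 ^+ 2 <= (g ^+ (K - q) * B) ^+ 2.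
  move=> /andP[l1 lq]; have lK : (l <= K)%N := leq_trans (lq : (l <= q)%N) hq.
  rewrite -enorm_subvec_sqr lerXn2r ?nnegrE ?enorm_ge0 //.
    by rewrite mulr_ge0 ?exprn_ge0 ?enorm_ge0.
  have := decay (K - l)%N; rewrite subKn // ltn_subrL l1 K1 => /(_ isT).
  move=> /le_trans; apply; rewrite ler_wpM2r ?enorm_ge0 //.
  (* As [l <= q], the exponent [K - l] is at least [K - q], and [g] is at most 1 by weak
     coupling. *)
  by rewrite ler_wiXn2l ?(ltW hweak) // leq_sub2l.
have gB0 : 0 <= g ^+ (K - q) * B by rewrite mulr_ge0 ?exprn_ge0 ?enorm_ge0.
apply: (@le_trans _ _ (Num.sqrt q%:R * (g ^+ (K - q) * B))).
  have ub0 := mulr_ge0 (sqrtr_ge0 q%:R) gB0.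
  (* Squares are compared: each of the [q] parts contributes at most [(g ^+ (K - q) * B) ^+ 2],
     whence the factor [Num.sqrt q%:R]. *)
  rewrite -(ler_pXn2r (_ : 0 < 2)%N) ?nnegrE ?enorm_ge0 //.
  rewrite enorm_coord_proj_sqr exprMn sqr_sqrtr ?ler0n //.
  apply: le_trans (sum_bigcup_nat_le _ _ _ _ _) _ => [i|].
    by rewrite sqr_ge0.
  rewrite big_nat; apply: le_trans (ler_sum _ part) _.
  by rewrite -big_nat sumr_const_nat subn1 mulr_natl.
have -> : 2 * Num.sqrt q%:R * #|T|%:R / N%:R * g ^+ (K - q)
    = Num.sqrt q%:R * (g ^+ (K - q) * (2 * #|T|%:R / N%:R)).
  by rewrite mulrC [2 * _]mulrC -!mulrA mulrCA.
by rewrite ler_wpM2l ?sqrtr_ge0 // ler_wpM2l ?exprn_ge0.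
Qed.
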